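(* Let $S(z)=\sum_{k\ge0}s_kz^k$ be the power series whose coefficients are defined by $s_0=1$ and, for all $k\ge0$, $s_{4k}=s_{4k+1}=s_k$, $s_{4k+2}=0$, and $s_{4k+3}=0$ if $k\equiv 3\pmod 4$, $s_{4k+3}=s_{k+1}$ otherwise (so $S(z)=1+z+z^3+z^4+z^5+z^{11}+z^{12}+z^{13}+z^{16}+z^{17}+z^{19}+\cdots$, and $S(z^{16})=-zS(z)+(1+z+z^2)S(z^4)$). Then for every integer $b\ge2$, \[\mu\left(S\left(\tfrac1b\right),S\left(\tfrac1{b^4}\right)\right)\le\tfrac{516}{253}.\] Moreover, if $a/b\in\mathbb{Q}$ with $a,b$ integers, $b\ge2$, $\log|a|=\lambda\log b$ and $0\le\lambda<178/291$, then \[\mu\left(S\left(\tfrac ab\right),S\left(\tfrac{a^4}{b^4}\right)\right)\le\frac{516(1-\lambda)}{253-381\lambda}.\]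
   Context: For real numbers $\alpha_1,\dots,\alpha_n$, the simultaneous approximation exponent $\mu(\alpha_1,\dots,\alpha_n)$ is the supremum of the real numbers $\mu$ such that the inequality $\max_{1\le i\le n}|\alpha_i-p_i/q|<q^{-\mu}$ has infinitely many solutions in rational numbers $p_i/q$ (with common denominator $q\ge1$). The coefficients $s_k$ lie in $\{0,1\}$, so $S$ converges for $|z|<1$. *)

(* Defs.v *)
From Stdlib Require Import Reals Lra Lia ZArith Arith.
From Coquelicot Require Import Coquelicot.
Open Scope R_scope.

(* The coefficients s_k, by (fuel-driven) strong recursion:
   s_0 = 1; s_{4k} = s_{4k+1} = s_k; s_{4k+2} = 0;
   s_{4k+3} = 0 if k = 3 mod 4, s_{k+1} otherwise.
   For n >= 1 every recursive call is on an index < n, so fuel n+1 suffices. *)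
Fixpoint s_fuel (fuel n : nat) : nat :=
  match fuel with
  | O => 0%nat
  | S f =>
    match n with
    | O => 1%nat
    | _ =>
      let k := Nat.div n 4 in
      match Nat.modulo n 4 with
      | 0 | 1 => s_fuel f k
      | 2 => 0%nat
      | _ => if Nat.eqb (Nat.modulo k 4) 3 then 0%nat else s_fuel f (k + 1)
      end
    end
  end.

Definition s (n : nat) : nat := s_fuel (S n) n.

Definition S_series (z : R) : R := Series (fun k => INR (s k) * z ^ k).

(* The inequality  max(|a1 - p1/q|, |a2 - p2/q|) < q^(-mu)  has infinitely many
   solutions (q, p1, p2) in integers with q >= 1. *)
Definition good_exponent2 (a1 a2 mu : R) : Prop :=
  forall N : Z, exists q p1 p2 : Z,
    (1 <= q)%Z /\ (Z.abs q + Z.abs p1 + Z.abs p2 > N)%Z /\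
    Rmax (Rabs (a1 - IZR p1 / IZR q)) (Rabs (a2 - IZR p2 / IZR q))
      < Rpower (IZR q) (- mu).

Definition mu2 (a1 a2 : R) : Rbar := Lub_Rbar (good_exponent2 a1 a2).

(* Main.v *)
Require Import Defs.
From Stdlib Require Import Reals ZArith.
From Coquelicot Require Import Coquelicot.
From Stdlib Require Import List Lra Lia.
Import ListNotations.
Open Scope R_scope.

(** Let [F = A0 + A1 S(z) + A2 S(z^4)], with integer polynomials of degree at most [n],
    vanish at [0] to order exactly [N].  By the functional equation, [F(z^(4^k))] is again
    a linear form in [1], [S(z)], [S(z^4)], now of degree about [(n + 2/3) 4^k] and order
    [N 4^k].  Evaluate it at [z = a/b], clear denominators by [b^((n + 2/3) 4^k)], and
    substitute [(q, p1, p2)] for [(1, S(z), S(z^4))], where the approximation error is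
    [eps = q^(-mu)].  If the resulting integer is zero then [eps >> |z|^(N 4^k)]; otherwise
    [1 << q b^((n + 2/3) 4^k) (|z|^(N 4^k) + eps)].  Because [N] is the exact order, one
    form thus excludes a whole range of [q] without any independence of several forms.
    Forms of orders 64, 108, 127, 171, followed by the iterate of order [4 * 64], give
    ranges that overlap as soon as [mu > 516 (1 - lambda) / (253 - 381 lambda)]. *)

(** * The coefficients *)

Lemma s_fuel_le_1 (f n : nat) : (s_fuel f n <= 1)%nat.
Proof.
  revert n; induction f as [|f IH]; intros n; [simpl; lia|].
  destruct n as [|n]; [simpl; lia|].
  cbn [s_fuel].
  destruct (Nat.modulo (S n) 4) as [|[|[|]]]; auto.
  destruct (Nat.eqb _ _); auto.
Qed.

Lemma s_fuel_enough (f g n : nat) :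
  (n < f)%nat -> (n < g)%nat -> s_fuel f n = s_fuel g n.
Proof.
  revert g n; induction f as [|f IH]; intros g n Hf Hg; [lia|].
  destruct g as [|g]; [lia|].
  destruct n as [|n]; [reflexivity|].
  cbn [s_fuel].
  pose proof (Nat.div_mod_eq (S n) 4) as E.
  pose proof (Nat.mod_upper_bound (S n) 4 ltac:(lia)) as B.
  set (k := Nat.div (S n) 4) in *.
  destruct (Nat.modulo (S n) 4) as [|[|[|]]].
  - apply IH; lia.
  - apply IH; lia.
  - reflexivity.
  - destruct (Nat.eqb _ _); [reflexivity|]. apply IH; lia.
Qed.

Lemma s_step (k r : nat) : (r < 4)%nat -> (0 < 4 * k + r)%nat ->
  s (4 * k + r) =
  match r with
  | 0 | 1 => s k
  | 2 => 0%nat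
  | _ => if Nat.eqb (Nat.modulo k 4) 3 then 0%nat else s (k + 1)
  end.
Proof.
  intros Hr Hp. unfold s at 1.
  assert (Hd : Nat.div (4 * k + r) 4 = k).
  { symmetry; apply (Nat.div_unique _ _ _ r); lia. }
  assert (Hm : Nat.modulo (4 * k + r) 4 = r).
  { symmetry; apply (Nat.mod_unique _ _ k); lia. }
  remember (4 * k + r)%nat as m eqn:Em.
  destruct m as [|m]; [lia|].
  remember (S m) as f eqn:Ef.
  assert (Hf : forall j, (j < f)%nat -> s_fuel f j = s j)
    by (intros; apply s_fuel_enough; lia).
  rewrite Ef at 2. cbn [s_fuel]. rewrite <- Ef, Hd, Hm.
  destruct r as [|[|[|[|r]]]]; try lia; try reflexivity.
  - apply Hf; lia.
  - apply Hf; lia.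
  - destruct (Nat.eqb _ _); [reflexivity|]. apply Hf; lia.
Qed.

Definition sZ (n : nat) : Z := Z.of_nat (s n).

(** The coefficients of [S(z^4)] as a power series in [z] (see [gen_u]), so that [S(z)] and [S(z^4)]
    can be truncated at the same order. *)
Definition uZ (n : nat) : Z :=
  if Nat.eqb (Nat.modulo n 4) 0 then sZ (Nat.div n 4) else 0%Z.

Lemma sZ_le_1 (n : nat) : (Z.abs (sZ n) <= 1)%Z.
Proof. unfold sZ, s. pose proof (s_fuel_le_1 (S n) n). lia. Qed.

Lemma uZ_le_1 (n : nat) : (Z.abs (uZ n) <= 1)%Z.
Proof. unfold uZ. destruct (Nat.eqb _ _); [apply sZ_le_1|simpl; lia]. Qed.

Lemma sZ_0 (k : nat) : sZ (4 * k) = sZ k.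
Proof.
  (* [s_step] starts at index 1; at index 0 the two sides coincide. *)
  destruct k as [|k]; [reflexivity|].
  unfold sZ. replace (4 * S k)%nat with (4 * S k + 0)%nat by lia.
  now rewrite s_step by lia.
Qed.

Lemma sZ_1 (k : nat) : sZ (4 * k + 1) = sZ k.
Proof. unfold sZ. now rewrite s_step by lia. Qed.

Lemma sZ_2 (k : nat) : sZ (4 * k + 2) = 0%Z.
Proof. unfold sZ. now rewrite s_step by lia. Qed.

Lemma uZ_0 (k : nat) : uZ (4 * k) = sZ k.
Proof.
  unfold uZ. rewrite Nat.mul_comm, Nat.Div0.mod_mul, Nat.div_mul by lia.
  reflexivity.
Qed.

Lemma uZ_r (k r : nat) : (0 < r < 4)%nat -> uZ (4 * k + r) = 0%Z.
Proof.
  intros Hr. unfold uZ.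
  replace (Nat.modulo (4 * k + r) 4) with r.
  - destruct r as [|r]; [lia|reflexivity].
  - apply (Nat.mod_unique _ _ k); lia.
Qed.

(* At [k + 1 = 4 j] both sides vanish, since [s_{4j} = s_j]. *)
Lemma sZ_3 (k : nat) : sZ (4 * k + 3) = (sZ (k + 1) - uZ (k + 1))%Z.
Proof.
  unfold sZ at 1. rewrite s_step by lia.
  pose proof (Nat.div_mod_eq k 4) as E.
  pose proof (Nat.mod_upper_bound k 4 ltac:(lia)) as B.
  destruct (Nat.eqb_spec (Nat.modulo k 4) 3) as [H|H].
  - replace (k + 1)%nat with (4 * (Nat.div k 4 + 1))%nat by lia.
    rewrite sZ_0, uZ_0. simpl; lia.
  - replace (k + 1)%nat with (4 * Nat.div k 4 + (Nat.modulo k 4 + 1))%nat by lia.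
    rewrite uZ_r by lia. fold (sZ (4 * Nat.div k 4 + (Nat.modulo k 4 + 1))). lia.
Qed.

(** * Power series with bounded integer coefficients *)

Definition gen (a : nat -> Z) (z : R) : R := Series (fun n => IZR (a n) * z ^ n).

Definition small (a : nat -> Z) : Prop := forall n, (Z.abs (a n) <= 1)%Z.

Lemma small_term (a : nat -> Z) (z : R) (n : nat) :
  small a -> Rabs (IZR (a n) * z ^ n) <= Rabs z ^ n.
Proof.
  intros Ha. rewrite Rabs_mult, RPow_abs, <- abs_IZR.
  rewrite <- (Rmult_1_l (Rabs (z ^ n))) at 2.
  apply Rmult_le_compat_r; [apply Rabs_pos|]. apply IZR_le, Ha.
Qed.

Lemma ex_series_abs_geom (z : R) : Rabs z < 1 -> ex_series (fun n => Rabs z ^ n).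
Proof. intros Hz. apply ex_series_geom. now rewrite Rabs_Rabsolu. Qed.

Lemma ex_gen (a : nat -> Z) (z : R) : small a -> Rabs z < 1 ->
  ex_series (fun n => IZR (a n) * z ^ n).
Proof.
  intros Ha Hz. apply (ex_series_le (V := R_CompleteNormedModule) _ (fun n => Rabs z ^ n)).
  - intros n. apply small_term, Ha.
  - now apply ex_series_abs_geom.
Qed.

(** Comparison with the geometric series, whose sum [1 / (1 - |z|)] is at most 2. *)
Lemma gen_bound (a : nat -> Z) (z : R) : small a -> Rabs z <= 1 / 2 ->
  Rabs (gen a z) <= 2.
Proof.
  intros Ha Hz. assert (Hz1 : Rabs z < 1) by lra. unfold gen.
  eapply Rle_trans; [apply Series_Rabs|].
  - apply (ex_series_le (V := R_CompleteNormedModule) _ (fun n => Rabs z ^ n)).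
    + intros n. simpl. unfold norm; simpl. unfold abs; simpl.
      rewrite Rabs_Rabsolu. apply small_term, Ha.
    + now apply ex_series_abs_geom.
  - eapply Rle_trans; [apply Series_le|].
    + intros n; split; [apply Rabs_pos|apply small_term, Ha].
    + now apply ex_series_abs_geom.
    + rewrite Series_geom by now rewrite Rabs_Rabsolu.
      apply (Rmult_le_reg_r (1 - Rabs z)); [lra|].
      rewrite Rinv_l by lra. lra.
Qed.

(** * Grouping terms by four, and the functional equation *)

Lemma is_lim_seq_blocks : filterlim (fun k => 4 * k + 3)%nat eventually eventually.
Proof.
  intros P [N HN]. exists N. intros n Hn. apply HN. lia.
Qed.

(** The partial sums of the grouped series are those of [a] at the indices [4 k + 3], a subsequence
    of a convergent sequence. *)
Lemma series_blocks (a b : nat -> R) (l : R) :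
  (forall k, b k = a (4 * k)%nat + a (4 * k + 1)%nat + a (4 * k + 2)%nat
                   + a (4 * k + 3)%nat) ->
  is_series a l -> is_series b l.
Proof.
  intros Hb Ha.
  assert (E : forall k, sum_n b k = sum_n a (4 * k + 3)).
  { induction k as [|k IH].
    - rewrite sum_O, Hb. change (4 * 0 + 3)%nat with 3%nat.
      rewrite !sum_Sn, sum_O. unfold plus; simpl. ring.
    - rewrite sum_Sn, IH, Hb.
      replace (4 * S k + 3)%nat with (S (S (S (S (4 * k + 3))))) by lia.
      rewrite !sum_Sn. unfold plus; cbn -[Nat.mul Nat.add].
      replace (S (4 * k + 3)) with (4 * S k)%nat by lia.
      replace (S (4 * S k)) with (4 * S k + 1)%nat by lia.
      replace (S (4 * S k + 1)) with (4 * S k + 2)%nat by lia.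
      replace (S (4 * S k + 2)) with (4 * S k + 3)%nat by lia.
      ring. }
  change (is_lim_seq (sum_n b) l).
  apply (is_lim_seq_ext (fun k => sum_n a (4 * k + 3))).
  - intros k; symmetry; apply E.
  - apply (is_lim_seq_subseq (sum_n a) l _ is_lim_seq_blocks). exact Ha.
Qed.

Lemma is_series_gen (a : nat -> Z) (z : R) : small a -> Rabs z < 1 ->
  is_series (fun n => IZR (a n) * z ^ n) (gen a z).
Proof. intros Ha Hz. now apply Series_correct, ex_gen. Qed.

Lemma pow4_lt_1 (z : R) : Rabs z < 1 -> Rabs (z ^ 4) < 1.
Proof.
  intros Hz. rewrite <- RPow_abs. apply pow_lt_1_compat; [split; [apply Rabs_pos|exact Hz]|lia].
Qed.

Lemma gen_u (z : R) : Rabs z < 1 -> gen uZ z = gen sZ (z ^ 4).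
Proof.
  intros Hz. symmetry. apply is_series_unique.
  apply (series_blocks (fun n => IZR (uZ n) * z ^ n)).
  - intros k. rewrite uZ_0, !uZ_r by lia. rewrite <- pow_mult. ring.
  - apply is_series_gen; [exact uZ_le_1|exact Hz].
Qed.

(** Group [z S(z)] by the residue of the index modulo 4. Residues 0 and 1 give [(z + z^2) S(z^4)],
    residue 2 gives nothing, and by [sZ_3] residue 3 gives the sum of
    [(s_{k+1} - u_{k+1}) z^(4(k+1))]. The last sum is [S(z^4) - S(z^16)], as the constant terms of
    these two series cancel. *)
Lemma gen_s_functional (z : R) : Rabs z < 1 ->
  gen sZ ((z ^ 4) ^ 4) = - z * gen sZ z + (1 + z + z ^ 2) * gen sZ (z ^ 4).
Proof.
  intros Hz. pose proof (pow4_lt_1 z Hz) as Hz4.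
  assert (Hl : is_series (fun n => z * (IZR (sZ n) * z ^ n)) (z * gen sZ z)).
  { apply (is_series_scal (K := R_AbsRing) (V := R_NormedModule) z).
    apply is_series_gen; [exact sZ_le_1|exact Hz]. }
  pose proof (is_series_gen sZ (z ^ 4) sZ_le_1 Hz4) as Hs.
  pose proof (is_series_gen uZ (z ^ 4) uZ_le_1 Hz4) as Hu.
  rewrite gen_u in Hu by exact Hz4.
  assert (Hd : is_series
     (fun n => IZR (sZ (S n)) * (z ^ 4) ^ S n - IZR (uZ (S n)) * (z ^ 4) ^ S n)
     (gen sZ (z ^ 4) - gen sZ ((z ^ 4) ^ 4))).
  { pose proof (is_series_minus _ _ _ _ Hs Hu) as H.
    apply (is_series_incr_1
      (fun n => IZR (sZ n) * (z ^ 4) ^ n - IZR (uZ n) * (z ^ 4) ^ n)).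
    match goal with |- is_series _ ?l =>
      replace l with (gen sZ (z ^ 4) - gen sZ ((z ^ 4) ^ 4)) end.
    - exact H.
    - unfold plus; simpl. change (uZ 0) with (sZ 0). ring. }
  pose proof (is_series_scal (K := R_AbsRing) (V := R_NormedModule) (z + z ^ 2) _ _ Hs) as Hm.
  pose proof (is_series_plus _ _ _ _ Hm Hd) as Hr.
  assert (E : z * gen sZ z =
     (z + z ^ 2) * gen sZ (z ^ 4) + (gen sZ (z ^ 4) - gen sZ ((z ^ 4) ^ 4))).
  { refine (eq_trans (eq_sym (is_series_unique _ _ _)) (is_series_unique _ _ Hr)).
    eapply series_blocks; [|exact Hl].
    intros k. unfold plus, scal, mult; cbn -[Nat.mul Nat.add pow].
    rewrite sZ_0, sZ_1, sZ_2, sZ_3, minus_IZR, !pow_add, pow_mult.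
    replace (k + 1)%nat with (S k) by lia. simpl. ring. }
  lra.
Qed.

Lemma S_series_gen (z : R) : S_series z = gen sZ z.
Proof.
  unfold S_series, gen. apply Series_ext. intros n. unfold sZ. now rewrite INR_IZR_INZ.
Qed.

(** * Integer polynomials as coefficient lists *)

Fixpoint peval (l : list Z) (z : R) : R :=
  match l with nil => 0 | c :: l => IZR c + z * peval l z end.

Fixpoint padd (l m : list Z) : list Z :=
  match l, m with
  | nil, _ => m
  | _, nil => l
  | a :: l, b :: m => (a + b)%Z :: padd l m
  end.

Fixpoint pmul (l m : list Z) : list Z :=
  match l with
  | nil => nil
  | a :: l => padd (map (Z.mul a) m) (0%Z :: pmul l m)
  end.

Fixpoint pnorm (l : list Z) : R :=
  match l with nil => 0 | c :: l => Rabs (IZR c) + pnorm l end.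

Lemma peval_padd (l m : list Z) (z : R) : peval (padd l m) z = peval l z + peval m z.
Proof.
  revert m; induction l as [|a l IH]; intros [|b m]; simpl; try ring.
  rewrite IH, plus_IZR. ring.
Qed.

Lemma peval_map_mul (a : Z) (l : list Z) (z : R) :
  peval (map (Z.mul a) l) z = IZR a * peval l z.
Proof. induction l as [|c l IH]; simpl; [ring|]. rewrite IH, mult_IZR. ring. Qed.

Lemma peval_pmul (l m : list Z) (z : R) : peval (pmul l m) z = peval l z * peval m z.
Proof.
  induction l as [|a l IH]; simpl; [ring|].
  rewrite peval_padd, peval_map_mul. simpl. rewrite IH. ring.
Qed.

Lemma pnorm_pos (l : list Z) : 0 <= pnorm l.
Proof. induction l as [|c l IH]; simpl; [lra|]. pose proof (Rabs_pos (IZR c)). lra. Qed.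

Lemma peval_bound (l : list Z) (z : R) : Rabs z <= 1 -> Rabs (peval l z) <= pnorm l.
Proof.
  intros Hz; induction l as [|c l IH]; simpl; [rewrite Rabs_R0; lra|].
  eapply Rle_trans; [apply Rabs_triang|]. rewrite Rabs_mult.
  pose proof (Rabs_pos (peval l z)). pose proof (Rabs_pos z). nra.
Qed.

Lemma peval_skip_zeros (N : nat) (l : list Z) (z : R) :
  forallb (Z.eqb 0) (firstn N l) = true -> (N <= length l)%nat ->
  peval l z = z ^ N * peval (skipn N l) z.
Proof.
  revert l; induction N as [|N IH]; intros l Hl Hn; [simpl; ring|].
  destruct l as [|c l]; [simpl in Hn; lia|].
  simpl in Hl, Hn |- *. apply andb_prop in Hl as [Hc Hl].
  assert (Hc0 : c = 0%Z) by (destruct c; [reflexivity|discriminate|discriminate]). subst c.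
  rewrite (IH l Hl) by lia. ring.
Qed.

Lemma gen_truncate (a : nat -> Z) (z : R) (K : nat) : small a -> Rabs z < 1 ->
  gen a z = peval (map a (seq 0 K)) z + z ^ K * gen (fun n => a (K + n)%nat) z.
Proof.
  revert a; induction K as [|K IH]; intros a Ha Hz.
  - simpl. rewrite Rplus_0_l, Rmult_1_l. reflexivity.
  - assert (E : gen a z = IZR (a 0%nat) + z * gen (fun n => a (S n)) z).
    { unfold gen at 1. rewrite Series_incr_1 by now apply ex_gen.
      simpl (z ^ 0). rewrite Rmult_1_r. f_equal.
      unfold gen. rewrite <- Series_scal_l. apply Series_ext. intros n. simpl. ring. }
    rewrite E, (IH (fun n => a (S n))) by (try exact Hz; intros n; apply Ha).
    cbn [seq map peval]. rewrite <- seq_shift, map_map. simpl. ring.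
Qed.

(** * Integrality of real numbers after clearing denominators *)

Definition isint (x : R) : Prop := exists i : Z, x = IZR i.

Lemma isint_IZR (i : Z) : isint (IZR i).
Proof. now exists i. Qed.

Lemma isint_plus (x y : R) : isint x -> isint y -> isint (x + y).
Proof. intros [i ->] [j ->]. exists (i + j)%Z. now rewrite plus_IZR. Qed.

Lemma isint_mult (x y : R) : isint x -> isint y -> isint (x * y).
Proof. intros [i ->] [j ->]. exists (i * j)%Z. now rewrite mult_IZR. Qed.

Lemma isint_opp (x : R) : isint x -> isint (- x).
Proof. intros [i ->]. exists (- i)%Z. now rewrite opp_IZR. Qed.

Lemma isint_pow (x : R) (n : nat) : isint x -> isint (x ^ n).
Proof.
  intros Hx; induction n as [|n IH]; simpl; [apply (isint_IZR 1)|].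
  now apply isint_mult.
Qed.

(** For [i <= n], [B^n w^i = B^(n-i) (B w)^i]. It is used with [B = b^(4^k)] and [w = z^(4^k)]. *)
Lemma isint_peval (B w : R) (l : list Z) (n : nat) :
  isint B -> isint (B * w) -> (length l <= S n)%nat -> isint (B ^ n * peval l w).
Proof.
  intros HB Hw; revert n; induction l as [|c l IH]; intros n Hn.
  - simpl. rewrite Rmult_0_r. apply (isint_IZR 0).
  - simpl in Hn |- *. destruct n as [|n].
    + destruct l; [|simpl in Hn; lia]. simpl.
      replace (1 * (IZR c + w * 0)) with (IZR c) by ring. apply isint_IZR.
    + replace (B ^ S n * (IZR c + w * peval l w))
        with (B ^ S n * IZR c + (B * w) * (B ^ n * peval l w)) by (simpl; ring).
      apply isint_plus; apply isint_mult; try assumption.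
      * now apply isint_pow.
      * apply isint_IZR.
      * apply IH. lia.
Qed.

(** * Linear forms in [1], [S(z)], [S(z^4)] and their iterates *)

Definition form (A0 A1 A2 : list Z) (w : R) : R :=
  peval A0 w + peval A1 w * gen sZ w + peval A2 w * gen sZ (w ^ 4).

(** Only the entries below index [K] are guaranteed to be Taylor coefficients of the form: later
    ones may miss contributions of the cut-off tails. [has_order] takes [K = N + 1], just enough to
    read the coefficient of [z^N]. *)
Definition form_trunc (A0 A1 A2 : list Z) (K : nat) : list Z :=
  padd A0 (padd (pmul A1 (map sZ (seq 0 K))) (pmul A2 (map uZ (seq 0 K)))).

(** A boolean, so that the explicit forms are checked by computation. With the default value 0, a
    list too short to have an entry [N] fails the test. *)
Definition has_order (A0 A1 A2 : list Z) (N : nat) : bool :=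
  let l := form_trunc A0 A1 A2 (S N) in
  forallb (Z.eqb 0) (firstn N l) && negb (Z.eqb (nth N l 0%Z) 0).

(** Near 0 the form equals [w^N (c0 + w t)] with [c0] a nonzero integer and [t] bounded. The lower
    bound, which rests on the order being exact, is what later controls the case of a vanishing
    integer. *)
Lemma form_order (A0 A1 A2 : list Z) (N : nat) : has_order A0 A1 A2 N = true ->
  exists c C delta : R, 0 < c /\ 0 < C /\ 0 < delta /\
  forall w, Rabs w <= delta ->
    c * Rabs w ^ N <= Rabs (form A0 A1 A2 w) <= C * Rabs w ^ N.
Proof.
  unfold has_order. cbv zeta.
  remember (form_trunc A0 A1 A2 (S N)) as l eqn:El. intros H.
  apply andb_prop in H as [H1 H2].
  apply Bool.negb_true_iff, Z.eqb_neq in H2.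
  assert (Hlen : (N < length l)%nat).
  { destruct (Nat.lt_ge_cases N (length l)) as [h|h]; [exact h|].
    exfalso; apply H2. now apply nth_overflow. }
  assert (Hsk : skipn N l = nth N l 0%Z :: skipn (S N) l).
  { clear -Hlen. revert l Hlen; induction N as [|N IH]; intros [|c l] Hl; simpl in *; try lia.
    - reflexivity.
    - rewrite IH by lia. reflexivity. }
  remember (nth N l 0%Z) as c0 eqn:Ec0.
  (* [M] bounds [t]: the entries of [l] beyond [N], plus the tails of the two series, each at most 2
     by [gen_bound]. *)
  set (M := pnorm (skipn (S N) l) + pnorm A1 * 2 + pnorm A2 * 2).
  assert (HM : 0 <= M).
  { unfold M. pose proof (pnorm_pos (skipn (S N) l)).
    pose proof (pnorm_pos A1). pose proof (pnorm_pos A2). lra. }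
  assert (Hc0 : 1 <= Rabs (IZR c0)).
  { rewrite <- abs_IZR. apply IZR_le. lia. }
  assert (E : forall w, Rabs w <= 1 / 2 -> exists t, Rabs t <= M /\
             form A0 A1 A2 w = w ^ N * (IZR c0 + w * t)).
  { intros w Hw. assert (Hw1 : Rabs w < 1) by lra.
    set (T1 := gen (fun n => sZ (S N + n)) w).
    set (T2 := gen (fun n => uZ (S N + n)) w).
    exists (peval (skipn (S N) l) w + peval A1 w * T1 + peval A2 w * T2). split.
    - assert (B1 : Rabs T1 <= 2) by (apply gen_bound; [intros n; apply sZ_le_1|exact Hw]).
      assert (B2 : Rabs T2 <= 2) by (apply gen_bound; [intros n; apply uZ_le_1|exact Hw]).
      eapply Rle_trans; [apply Rabs_triang|]. unfold M. apply Rplus_le_compat.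
      + eapply Rle_trans; [apply Rabs_triang|]. apply Rplus_le_compat.
        * apply peval_bound; lra.
        * rewrite Rabs_mult. apply Rmult_le_compat; try apply Rabs_pos; [|exact B1].
          apply peval_bound; lra.
      + rewrite Rabs_mult. apply Rmult_le_compat; try apply Rabs_pos; [|exact B2].
        apply peval_bound; lra.
    - unfold form. rewrite <- gen_u by exact Hw1.
      rewrite (gen_truncate sZ w (S N)) by (try exact sZ_le_1; exact Hw1).
      rewrite (gen_truncate uZ w (S N)) by (try exact uZ_le_1; exact Hw1).
      fold T1 T2.
      assert (P : peval l w = w ^ N * (IZR c0 + w * peval (skipn (S N) l) w)).
      { rewrite (peval_skip_zeros N l w H1) by lia. rewrite Hsk. reflexivity. }
      rewrite El in P at 1. unfold form_trunc in P.
      rewrite !peval_padd, !peval_pmul in P.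
      replace (w ^ S N) with (w ^ N * w) by (simpl; ring).
      match type of P with ?u = _ => transitivity (u + w ^ N * w * (peval A1 w * T1 + peval A2 w * T2)) end.
      + ring.
      + rewrite P. ring. }
  (* This radius makes [|w t| <= 1/2 <= |c0| / 2]. *)
  exists (Rabs (IZR c0) / 2), (Rabs (IZR c0) + M), (Rmin (1 / 2) (1 / (2 * (M + 1)))).
  assert (Hi : 0 < 1 / (2 * (M + 1))) by (apply Rdiv_lt_0_compat; lra).
  split; [lra|]. split; [lra|]. split; [apply Rmin_glb_lt; lra|].
  intros w Hw.
  assert (Hw1 : Rabs w <= 1 / 2) by (eapply Rle_trans; [exact Hw|apply Rmin_l]).
  assert (Hw2 : Rabs w <= 1 / (2 * (M + 1))) by (eapply Rle_trans; [exact Hw|apply Rmin_r]).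
  destruct (E w Hw1) as (t & Ht & ->).
  rewrite Rabs_mult, <- RPow_abs.
  assert (Hp : 0 <= Rabs w ^ N) by (apply pow_le, Rabs_pos).
  assert (Hwt : Rabs (w * t) <= 1 / 2 /\ Rabs (w * t) <= M).
  { rewrite Rabs_mult. pose proof (Rabs_pos w). pose proof (Rabs_pos t).
    assert (Rabs w * (M + 1) <= 1 / 2).
    { apply Rmult_le_reg_r with (/ (M + 1)); [apply Rinv_0_lt_compat; lra|].
      rewrite Rmult_assoc, Rinv_r by lra.
      replace (1 / 2 * / (M + 1)) with (1 / (2 * (M + 1))) by (field; lra). lra. }
    split; nra. }
  assert (U : Rabs (IZR c0 + w * t) <= Rabs (IZR c0) + Rabs (w * t)) by apply Rabs_triang.
  assert (D : Rabs (IZR c0) - Rabs (w * t) <= Rabs (IZR c0 + w * t)).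
  { pose proof (Rabs_triang_inv (IZR c0) (- (w * t))) as H. rewrite Rabs_Ropp in H.
    replace (IZR c0 - - (w * t)) with (IZR c0 + w * t) in H by ring. lra. }
  split; rewrite (Rmult_comm (Rabs w ^ N)); apply Rmult_le_compat_r; lra.
Qed.

(* [e_k = 2 (1 + 4 + ... + 4^(k-1))] is the degree of the product of the [k] transfer
   matrices [[0, 1], [-z, 1 + z + z^2]] taken at [z^(4^(k-1)), ..., z]. *)
Fixpoint transfer_deg (k : nat) : nat :=
  match k with O => O | S k => (transfer_deg k + 2 * 4 ^ k)%nat end.

Lemma transfer_deg_eq (k : nat) : (3 * transfer_deg k + 2 = 2 * 4 ^ k)%nat.
Proof. induction k as [|k IH]; simpl; lia. Qed.

(** The functional equation at [w = z^(4^k)] turns the coefficients [(x, y)] at level [k + 1] into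
    [(-w y, x + (1 + w + w^2) y)] at level [k]. Being of degree 2 in [w], this costs a factor
    [b^(2 * 4^k)] of denominator. With [u = |w|] the sum [|x| + |y|] grows by at most [(1 + u)^2];
    the bound is stated so that these factors telescope and stay bounded as [k] grows. *)
Lemma transfer (b z : R) (k d : nat) (x y : R) :
  isint b -> isint (b * z) -> Rabs z < 1 ->
  isint (b ^ d * x) -> isint (b ^ d * y) ->
  exists x' y',
    x * gen sZ (z ^ (4 ^ k)) + y * gen sZ ((z ^ (4 ^ k)) ^ 4)
      = x' * gen sZ z + y' * gen sZ (z ^ 4) /\
    isint (b ^ (d + transfer_deg k) * x') /\
    isint (b ^ (d + transfer_deg k) * y') /\
    Rabs x' + Rabs y' <=
      (Rabs x + Rabs y) * ((1 - Rabs z ^ (4 ^ k)) / (1 - Rabs z)) ^ 2.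
Proof.
  intros Hb Hbz Hz. revert d x y; induction k as [|k IH]; intros d x y Hx Hy.
  - exists x, y. simpl (4 ^ 0)%nat. rewrite !pow_1, Nat.add_0_r.
    repeat split; try assumption.
    replace ((1 - Rabs z) / (1 - Rabs z)) with 1 by (field; lra). lra.
  - set (w := z ^ (4 ^ k)).
    assert (Ew : z ^ (4 ^ S k) = w ^ 4).
    { unfold w. rewrite <- pow_mult. f_equal. simpl; lia. }
    set (u := Rabs z ^ (4 ^ k)).
    assert (Eu : Rabs w = u) by (unfold w, u; now rewrite RPow_abs).
    assert (Hu : 0 <= u <= 1).
    { split; [apply pow_le, Rabs_pos|].
      unfold u. rewrite <- (pow1 (4 ^ k)). apply pow_incr.
      split; [apply Rabs_pos|lra]. }
    assert (Hw : Rabs w < 1).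
    { rewrite Eu. apply pow_lt_1_compat; [split; [apply Rabs_pos|exact Hz]|].
      pose proof (transfer_deg_eq k). lia. }
    assert (Hbw : isint (b ^ (4 ^ k) * w)).
    { unfold w. rewrite <- Rpow_mult_distr. now apply isint_pow. }
    assert (Hbk : isint (b ^ (4 ^ k))) by now apply isint_pow.
    destruct (IH (d + 2 * 4 ^ k)%nat (- w * y) (x + (1 + w + w ^ 2) * y))
      as (x' & y' & E & Ix & Iy & Hn).
    + replace (b ^ (d + 2 * 4 ^ k) * (- w * y))
        with (- ((b ^ (4 ^ k) * w) * (b ^ (4 ^ k) * (b ^ d * y)))).
      * apply isint_opp. repeat first [assumption | apply isint_mult].
      * rewrite pow_add, (Nat.mul_comm 2), pow_mult. ring.
    + replace (b ^ (d + 2 * 4 ^ k) * (x + (1 + w + w ^ 2) * y))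
        with (b ^ (4 ^ k) * (b ^ (4 ^ k) * (b ^ d * x))
          + (b ^ (4 ^ k) * b ^ (4 ^ k) + b ^ (4 ^ k) * (b ^ (4 ^ k) * w)
             + (b ^ (4 ^ k) * w) * (b ^ (4 ^ k) * w)) * (b ^ d * y)).
      * repeat first [assumption | apply isint_plus | apply isint_mult].
      * rewrite pow_add, (Nat.mul_comm 2), pow_mult. ring.
    + exists x', y'.
      replace (d + transfer_deg (S k))%nat with (d + 2 * 4 ^ k + transfer_deg k)%nat
        by (cbn [transfer_deg]; lia).
      repeat split; try assumption.
      * rewrite <- E, Ew. fold w. rewrite (gen_s_functional w Hw). ring.
      * eapply Rle_trans; [exact Hn|].
        replace (Rabs z ^ (4 ^ S k)) with (u ^ 4)
          by (unfold u; rewrite <- pow_mult; f_equal; simpl; lia).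
        fold u.
        assert (N1 : Rabs (- w * y) + Rabs (x + (1 + w + w ^ 2) * y)
                     <= (Rabs x + Rabs y) * (1 + u) ^ 2).
        { rewrite Rabs_mult, Rabs_Ropp, Eu.
          assert (T : Rabs (x + (1 + w + w ^ 2) * y) <= Rabs x + (1 + u + u ^ 2) * Rabs y).
          { eapply Rle_trans; [apply Rabs_triang|]. rewrite Rabs_mult.
            apply Rplus_le_compat_l, Rmult_le_compat_r; [apply Rabs_pos|].
            eapply Rle_trans; [apply Rabs_triang|].
            rewrite <- RPow_abs, Eu. apply Rplus_le_compat_r.
            eapply Rle_trans; [apply Rabs_triang|]. rewrite Rabs_R1, Eu. lra. }
          pose proof (Rabs_pos x). pose proof (Rabs_pos y).
          assert (0 <= Rabs x * u) by (apply Rmult_le_pos; lra).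
          assert (0 <= Rabs x * u * u) by (apply Rmult_le_pos; lra).
          nra. }
        assert (Hi : 0 < / (1 - Rabs z)) by (apply Rinv_0_lt_compat; lra).
        eapply Rle_trans; [apply Rmult_le_compat_r; [apply pow2_ge_0|exact N1]|].
        rewrite Rmult_assoc, <- Rpow_mult_distr.
        pose proof (Rabs_pos x). pose proof (Rabs_pos y).
        apply Rmult_le_compat_l; [lra|]. apply pow_incr. unfold Rdiv. split.
        -- apply Rmult_le_pos; [lra|]. apply Rmult_le_pos; lra.
        -- rewrite <- Rmult_assoc. apply Rmult_le_compat_r; [lra|].
           (* [(1 + u)(1 - u) = 1 - u^2 <= 1 - u^4]. *)
           assert (0 <= u ^ 2 <= 1) by nra. nra.
Qed.

(** * The gap principle *)

Lemma isint_ge_1 (x : R) : isint x -> x <> 0 -> 1 <= Rabs x.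
Proof.
  intros [i ->] H. rewrite <- abs_IZR. apply IZR_le.
  assert (i <> 0%Z) by (intros ->; now apply H). lia.
Qed.

Lemma iterate_small (z delta : R) : Rabs z < 1 -> 0 < delta ->
  exists K, forall k, (K <= k)%nat -> Rabs (z ^ (4 ^ k)) <= delta.
Proof.
  intros Hz Hd. destruct (pow_lt_1_zero z Hz delta Hd) as [K HK].
  exists K. intros k Hk. apply Rlt_le, HK.
  pose proof (Nat.pow_gt_lin_r 4 k ltac:(lia)). lia.
Qed.

(* With [w = z^(4^k)], the iterated form takes at [(q, p1, p2)] a value that is an
   integer after multiplication by [b^d].  If it vanishes, then
   [|w|^N << |form w| << eps]; otherwise [1 << q b^d (|w|^N + eps)].  The first is
   excluded when [eps << |w|^N], and then the second gives the conclusion. *)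
Lemma form_gap (A0 A1 A2 : list Z) (n N : nat) (b z : R) :
  has_order A0 A1 A2 N = true ->
  (length A0 <= S n)%nat -> (length A1 <= S n)%nat -> (length A2 <= S n)%nat ->
  isint b -> isint (b * z) -> 0 < b -> Rabs z < 1 ->
  exists (C : R) (K : nat), 1 <= C /\
  forall (k : nat) (q p1 p2 : Z) (eps : R), (K <= k)%nat -> (1 <= q)%Z ->
    Rabs (gen sZ z - IZR p1 / IZR q) <= eps ->
    Rabs (gen sZ (z ^ 4) - IZR p2 / IZR q) <= eps ->
    C * eps < Rabs z ^ (4 ^ k * N) ->
    1 <= C * (IZR q * b ^ (4 ^ k * n + transfer_deg k) * Rabs z ^ (4 ^ k * N)).
Proof.
  intros Hord L0 L1 L2 Hb Hbz Hb0 Hz.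
  destruct (form_order _ _ _ _ Hord) as (c & C2 & delta & Hc & HC2 & Hdelta & HF).
  destruct (iterate_small z delta Hz Hdelta) as [K HK].
  (* A bound, uniform in [k], for the coefficients that [transfer] produces. *)
  set (C1 := (pnorm A1 + pnorm A2) * (1 / (1 - Rabs z)) ^ 2).
  assert (Hi : 0 < 1 / (1 - Rabs z)) by (apply Rdiv_lt_0_compat; lra).
  assert (HC1 : 0 <= C1).
  { apply Rmult_le_pos; [|apply pow2_ge_0].
    pose proof (pnorm_pos A1). pose proof (pnorm_pos A2). lra. }
  assert (HC1c : 0 <= C1 / c) by (apply Rmult_le_pos; [lra|apply Rlt_le, Rinv_0_lt_compat, Hc]).
  (* The summand 1 gives [eps <= h], [C1 / c] excludes [Lam = 0], and [C1 + C2] bounds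
     [|r - err| / h]. *)
  exists (1 + C1 / c + C1 + C2), K. split; [lra|].
  intros k q p1 p2 eps Hk Hq E1 E2 Heps.
  assert (Heps0 : 0 <= eps) by (eapply Rle_trans; [apply Rabs_pos|exact E1]).
  assert (HqR : 1 <= IZR q) by now apply IZR_le.
  specialize (HF _ (HK k Hk)).
  rewrite <- RPow_abs, <- pow_mult in HF.
  set (h := Rabs z ^ (4 ^ k * N)) in *.
  assert (Hh : 0 <= h) by (apply pow_le, Rabs_pos).
  set (w := z ^ (4 ^ k)) in *.
  assert (Hw : Rabs w <= 1).
  { unfold w. rewrite <- RPow_abs. rewrite <- (pow1 (4 ^ k)). apply pow_incr.
    split; [apply Rabs_pos|lra]. }
  assert (I : forall l, (length l <= S n)%nat -> isint (b ^ (4 ^ k * n) * peval l w)).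
  { intros l Hl. rewrite pow_mult. apply isint_peval; [now apply isint_pow| |exact Hl].
    unfold w. rewrite <- Rpow_mult_distr. now apply isint_pow. }
  destruct (transfer b z k (4 ^ k * n) (peval A1 w) (peval A2 w) Hb Hbz Hz (I _ L1) (I _ L2))
    as (x & y & Exy & Ix & Iy & Hxy).
  fold w in Exy.
  assert (I0 : isint (b ^ (4 ^ k * n + transfer_deg k) * peval A0 w)).
  { rewrite pow_add, Rmult_assoc, (Rmult_comm (b ^ transfer_deg k)), <- Rmult_assoc.
    apply isint_mult; [now apply I|now apply isint_pow]. }
  set (B := b ^ (4 ^ k * n + transfer_deg k)) in *.
  assert (HB : 0 < B) by now apply pow_lt.
  assert (HxyC : Rabs x + Rabs y <= C1).
  { eapply Rle_trans; [exact Hxy|].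
    assert (H4 : 0 <= Rabs z ^ (4 ^ k) <= 1).
    { split; [apply pow_le, Rabs_pos|]. rewrite RPow_abs. exact Hw. }
    apply Rmult_le_compat.
    - apply Rplus_le_le_0_compat; apply Rabs_pos.
    - apply pow2_ge_0.
    - apply Rplus_le_compat; now apply peval_bound.
    - apply pow_incr. unfold Rdiv in *. split.
      + apply Rmult_le_pos; lra.
      + apply Rmult_le_compat_r; lra. }
  set (r := form A0 A1 A2 w) in *.
  assert (Er : r = peval A0 w + (x * gen sZ z + y * gen sZ (z ^ 4))).
  { unfold r, form. rewrite <- Exy. ring. }
  set (Lam := (B * peval A0 w) * IZR q + (B * x) * IZR p1 + (B * y) * IZR p2).
  assert (ILam : isint Lam).
  { unfold Lam. repeat first [assumption | apply isint_IZR | apply isint_plus | apply isint_mult]. }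
  set (err := x * (gen sZ z - IZR p1 / IZR q) + y * (gen sZ (z ^ 4) - IZR p2 / IZR q)).
  assert (ELam : Lam = IZR q * B * (r - err)).
  { rewrite Er. unfold Lam, err. field. lra. }
  assert (Herr : Rabs err <= C1 * eps).
  { unfold err. eapply Rle_trans; [apply Rabs_triang|]. rewrite !Rabs_mult.
    apply Rle_trans with ((Rabs x + Rabs y) * eps).
    - rewrite Rmult_plus_distr_r.
      apply Rplus_le_compat; apply Rmult_le_compat_l; (apply Rabs_pos || assumption).
    - now apply Rmult_le_compat_r. }
  assert (Heps1 : eps <= h).
  { assert (0 <= (C1 / c + C1 + C2) * eps) by (apply Rmult_le_pos; lra). lra. }
  assert (Hne : Lam <> 0).
  { intros H0. assert (r = err).
    { rewrite H0 in ELam. symmetry in ELam.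
      apply Rmult_integral in ELam as [H|H]; [|lra].
      apply Rmult_integral in H as [H|H]; lra. }
    assert (Hlow : c * h <= C1 * eps) by (rewrite H in HF; lra).
    assert (Hup : C1 * eps <= c * ((C1 / c) * eps)) by (right; field; lra).
    assert (0 <= (1 + C1 + C2) * eps) by (apply Rmult_le_pos; lra).
    assert (C1 / c * eps < h) by lra.
    assert (c * (C1 / c * eps) < c * h) by now apply Rmult_lt_compat_l.
    lra. }
  apply isint_ge_1 in Hne; [|exact ILam].
  rewrite ELam, !Rabs_mult, (Rabs_pos_eq (IZR q)), (Rabs_pos_eq B) in Hne by lra.
  assert (HqB : 0 <= IZR q * B) by (apply Rmult_le_pos; lra).
  assert (Hre : Rabs (r - err) <= (1 + C1 / c + C1 + C2) * h).
  { apply Rle_trans with (C2 * h + C1 * h).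
    - replace (r - err) with (r + - err) by ring.
      eapply Rle_trans; [apply Rabs_triang|]. rewrite Rabs_Ropp.
      apply Rplus_le_compat; [lra|].
      eapply Rle_trans; [exact Herr|]. now apply Rmult_le_compat_l.
    - assert (0 <= (1 + C1 / c) * h) by (apply Rmult_le_pos; lra). lra. }
  eapply Rle_trans; [exact Hne|].
  eapply Rle_trans; [apply Rmult_le_compat_l; [exact HqB|exact Hre]|].
  right; ring.
Qed.

(** * The gap principle in logarithms *)

Definition Dist (z : R) (q p1 p2 : Z) : R :=
  Rmax (Rabs (gen sZ z - IZR p1 / IZR q)) (Rabs (gen sZ (z ^ 4) - IZR p2 / IZR q)).

(* The logarithmic form of the gap principle: [beta = ln b] and [L = - ln |z|]. *)
Definition gap (z beta L : R) (n N : nat) (c : R) : Prop :=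
  exists K : nat, forall (k : nat) (q p1 p2 : Z) (mu : R), (K <= k)%nat -> (1 <= q)%Z ->
    Dist z q p1 p2 < Rpower (IZR q) (- mu) ->
    L * INR N * 4 ^ k < mu * ln (IZR q) - c ->
    (L * INR N - beta * (INR n + 2 / 3)) * 4 ^ k <= ln (IZR q) + c.

(** This lets all the forms share one constant. *)
Lemma gap_weaken (z beta L c c' : R) (n N : nat) :
  c <= c' -> gap z beta L n N c -> gap z beta L n N c'.
Proof.
  intros Hc [K HK]. exists K. intros k q p1 p2 mu Hk Hq Hd Hl.
  specialize (HK k q p1 p2 mu Hk Hq Hd ltac:(lra)). lra.
Qed.

(** Logarithms of [form_gap] with [eps = q^(-mu)] and [c = ln C]. The term [2 / 3] comes from
    [transfer_deg k <= (2/3) 4^k]. *)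
Lemma form_gap_ln (A0 A1 A2 : list Z) (n N : nat) (b z beta L : R) :
  has_order A0 A1 A2 N = true ->
  (length A0 <= S n)%nat -> (length A1 <= S n)%nat -> (length A2 <= S n)%nat ->
  isint b -> isint (b * z) -> 0 <= beta -> 0 < L -> b = exp beta -> Rabs z = exp (- L) ->
  exists c, 0 <= c /\ gap z beta L n N c.
Proof.
  intros Hord L0 L1 L2 Hb Hbz Hbeta HL Eb Ez.
  assert (Hz1 : Rabs z < 1).
  { rewrite Ez, <- exp_0. apply exp_increasing. lra. }
  assert (Hb0 : 0 < b) by (rewrite Eb; apply exp_pos).
  destruct (form_gap A0 A1 A2 n N b z Hord L0 L1 L2 Hb Hbz Hb0 Hz1) as (C & K & HC & HG).
  exists (ln C). split; [rewrite <- ln_1; apply ln_le; lra|].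
  exists K. intros k q p1 p2 mu Hk Hq Hd Hl.
  assert (HqR : 1 <= IZR q) by now apply IZR_le.
  assert (Epow : forall x m, exp x ^ m = exp (INR m * x)).
  { intros x m. induction m as [|m IH]; [simpl; rewrite Rmult_0_l, exp_0; reflexivity|].
    rewrite S_INR. simpl. rewrite IH, <- exp_plus. f_equal. ring. }
  assert (E4 : INR (4 ^ k) = 4 ^ k) by (rewrite pow_INR; f_equal; simpl; ring).
  specialize (HG k q p1 p2 (Rpower (IZR q) (- mu)) Hk Hq).
  unfold Dist in Hd.
  specialize (HG (Rlt_le _ _ (Rle_lt_trans _ _ _ (Rmax_l _ _) Hd))).
  specialize (HG (Rlt_le _ _ (Rle_lt_trans _ _ _ (Rmax_r _ _) Hd))).
  assert (Eq : IZR q = exp (ln (IZR q))) by (rewrite exp_ln; lra).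
  assert (EC : C = exp (ln C)) by (rewrite exp_ln; lra).
  rewrite Ez, Epow, mult_INR, E4 in HG.
  rewrite Eb, Epow, plus_INR, mult_INR, E4 in HG.
  assert (Hpre : C * Rpower (IZR q) (- mu) < exp (4 ^ k * INR N * - L)).
  { rewrite EC. unfold Rpower. rewrite <- exp_plus. apply exp_increasing.
    replace (4 ^ k * INR N * - L) with (- (L * INR N * 4 ^ k)) by ring. lra. }
  specialize (HG Hpre). rewrite EC, Eq, <- !exp_plus, <- exp_0 in HG.
  assert (Hexp : 0 <= ln C + (ln (IZR q)
      + (4 ^ k * INR n + INR (transfer_deg k)) * beta + 4 ^ k * INR N * - L)).
  { apply Rnot_lt_le. intros H. apply exp_increasing in H. lra. }
  assert (Ht : 3 * INR (transfer_deg k) + 2 = 2 * 4 ^ k).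
  { rewrite <- E4. pose proof (f_equal INR (transfer_deg_eq k)) as H.
    rewrite plus_INR, !mult_INR in H. simpl in H. lra. }
  assert (Hle : INR (transfer_deg k) * beta <= 2 / 3 * 4 ^ k * beta)
    by (apply Rmult_le_compat_r; lra).
  lra.
Qed.

(** * Covering all large denominators by a chain of forms *)

Lemma good_exponent2_large (a1 a2 mu T : R) : good_exponent2 a1 a2 mu -> 0 <= mu ->
  exists q p1 p2 : Z, (1 <= q)%Z /\ T < ln (IZR q) /\
    Rmax (Rabs (a1 - IZR p1 / IZR q)) (Rabs (a2 - IZR p2 / IZR q))
      < Rpower (IZR q) (- mu).
Proof.
  intros Hg Hmu. set (X := exp T). assert (HX : 0 < X) by apply exp_pos.
  (* If [ln q <= T], then [q <= X]; as the errors are below [q^(-mu) <= 1], each [|p_i|] is at most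
     [X (|a_i| + 1)]. So a solution whose sum exceeds [Y] has a large [q]. *)
  set (Y := X + X * (Rabs a1 + 1) + X * (Rabs a2 + 1)).
  destruct (Hg (up Y)) as (q & p1 & p2 & Hq & Hsum & Hd).
  exists q, p1, p2. split; [exact Hq|]. split; [|exact Hd].
  assert (HqR : 1 <= IZR q) by now apply IZR_le.
  apply Rnot_le_lt. intros HT.
  assert (HqX : IZR q <= X).
  { rewrite <- (exp_ln (IZR q)) by lra. unfold X.
    destruct HT as [HT|HT]; [left; now apply exp_increasing|right; now rewrite HT]. }
  assert (H1 : Rpower (IZR q) (- mu) <= 1).
  { rewrite <- (Rpower_O (IZR q)) by lra. apply Rle_Rpower; lra. }
  assert (Hp : forall a p, Rabs (a - IZR p / IZR q) < 1 -> IZR (Z.abs p) <= X * (Rabs a + 1)).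
  { intros a p H. rewrite abs_IZR.
    assert (E : IZR p = IZR q * (a - (a - IZR p / IZR q))) by (field; lra).
    rewrite E, Rabs_mult, (Rabs_pos_eq (IZR q)) by lra.
    apply Rmult_le_compat; [lra|apply Rabs_pos|exact HqX|].
    unfold Rminus at 1. eapply Rle_trans; [apply Rabs_triang|]. rewrite Rabs_Ropp. lra. }
  pose proof (Rmax_l (Rabs (a1 - IZR p1 / IZR q)) (Rabs (a2 - IZR p2 / IZR q))).
  pose proof (Rmax_r (Rabs (a1 - IZR p1 / IZR q)) (Rabs (a2 - IZR p2 / IZR q))).
  pose proof (Hp a1 p1 ltac:(lra)). pose proof (Hp a2 p2 ltac:(lra)).
  assert (Hs : IZR (up Y) < IZR (Z.abs q + Z.abs p1 + Z.abs p2)) by (apply IZR_lt; lia).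
  rewrite !plus_IZR, (Z.abs_eq q) in Hs by lia.
  destruct (archimed Y) as [HY _]. unfold Y in HY at 2. lra.
Qed.

(** This selects the iterate [k] from the size of [U = mu ln q - c]. *)
Lemma pow4_bracket (A U : R) (K : nat) : 0 < A -> A * 4 ^ K < U ->
  exists k, (K <= k)%nat /\ A * 4 ^ k < U <= A * 4 ^ S k.
Proof.
  intros HA HK.
  destruct (Pow_x_infinity 4 ltac:(rewrite Rabs_pos_eq; lra) (U / A)) as [M HM].
  specialize (HM (K + M)%nat ltac:(lia)).
  rewrite Rabs_pos_eq in HM by (apply pow_le; lra).
  assert (HU : U <= A * 4 ^ (K + M)).
  { apply Rge_le, (Rmult_le_compat_l A) in HM; [|lra].
    replace (A * (U / A)) with U in HM by (field; lra). exact HM. }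
  clear HM. induction M as [|M IH].
  - rewrite Nat.add_0_r in HU. lra.
  - destruct (Rle_lt_dec U (A * 4 ^ (K + M))) as [H|H]; [now apply IH|].
    exists (K + M)%nat. rewrite Nat.add_succ_r in HU. repeat split; [lia|exact H|exact HU].
Qed.

(* A chain of four forms of orders [N0 < N1 < N2 < N3]; after the last one the next
   iterate of the first, of order [4 N0], takes over. *)
Lemma mu2_chain (z beta L c m : R) (n0 n1 n2 n3 N0 N1 N2 N3 : nat) :
  0 < L -> 0 <= c -> 0 < m -> (0 < N0)%nat ->
  gap z beta L n0 N0 c -> gap z beta L n1 N1 c ->
  gap z beta L n2 N2 c -> gap z beta L n3 N3 c ->
  L * INR N1 <= m * (L * INR N0 - beta * (INR n0 + 2 / 3)) ->
  L * INR N2 <= m * (L * INR N1 - beta * (INR n1 + 2 / 3)) ->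
  L * INR N3 <= m * (L * INR N2 - beta * (INR n2 + 2 / 3)) ->
  L * (4 * INR N0) <= m * (L * INR N3 - beta * (INR n3 + 2 / 3)) ->
  Rbar_le (mu2 (gen sZ z) (gen sZ (z ^ 4))) (Finite m).
Proof.
  intros HL Hc Hm HN0 [K0 G0] [K1 G1] [K2 G2] [K3 G3] I0 I1 I2 I3.
  unfold mu2. apply (proj2 (Lub_Rbar_correct _)). intros mu Hgood.
  apply Rnot_lt_le. intros Hlt.
  set (K := (K0 + K1 + K2 + K3)%nat).
  set (A := L * INR N0).
  assert (HA : 0 < A) by (apply Rmult_lt_0_compat; [exact HL|now apply lt_0_INR]).
  (* Beyond the first bound the iterate is past every threshold [K_i]; beyond the second,
     [(mu - m) ln q] outweighs the additive constants. *)
  set (T := Rmax ((A * 4 ^ K + c) / mu) ((m + 1) * c / (mu - m))).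
  destruct (good_exponent2_large _ _ mu T Hgood ltac:(lra)) as (q & p1 & p2 & Hq & HT & Hd).
  set (t := ln (IZR q)) in *.
  assert (T1 : A * 4 ^ K < mu * t - c).
  { assert (H : (A * 4 ^ K + c) / mu < t) by (eapply Rle_lt_trans; [apply Rmax_l|exact HT]).
    apply (Rmult_lt_compat_l mu) in H; [|lra].
    replace (mu * ((A * 4 ^ K + c) / mu)) with (A * 4 ^ K + c) in H by (field; lra). lra. }
  assert (T2 : (m + 1) * c < (mu - m) * t).
  { assert (H : (m + 1) * c / (mu - m) < t) by (eapply Rle_lt_trans; [apply Rmax_r|exact HT]).
    apply (Rmult_lt_compat_l (mu - m)) in H; [|lra].
    replace ((mu - m) * ((m + 1) * c / (mu - m))) with ((m + 1) * c) in H by (field; lra).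
    lra. }
  destruct (pow4_bracket A (mu * t - c) K HA T1) as (k & Hk & Hlo & Hhi).
  assert (P : 0 < 4 ^ k) by (apply pow_lt; lra).
  (* Here [X] is the next order and [Y] the gap rate of the current form. Together they give
     [mu t - c <= m (t + c)], against [T2]. *)
  assert (Fin : forall X Y, L * X <= m * Y -> mu * t - c <= L * X * 4 ^ k ->
                  Y * 4 ^ k <= t + c -> False).
  { intros X Y HXY Hup HY.
    assert (H1 : L * X * 4 ^ k <= m * Y * 4 ^ k) by (apply Rmult_le_compat_r; lra).
    assert (H2 : m * (Y * 4 ^ k) <= m * (t + c)) by (apply Rmult_le_compat_l; lra).
    lra. }
  fold (Dist z q p1 p2) in Hd. unfold A, K in *.
  specialize (G0 k q p1 p2 mu ltac:(lia) Hq Hd Hlo).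
  specialize (G1 k q p1 p2 mu ltac:(lia) Hq Hd).
  specialize (G2 k q p1 p2 mu ltac:(lia) Hq Hd).
  specialize (G3 k q p1 p2 mu ltac:(lia) Hq Hd).
  fold t in G0, G1, G2, G3.
  (* The last form in the chain whose order satisfies [L N_i 4^k < mu t - c] yields the
     contradiction; for the fourth form the upper bound is that of the bracket. *)
  destruct (Rle_lt_dec (mu * t - c) (L * INR N1 * 4 ^ k)) as [H|H];
    [now apply (Fin _ _ I0)|specialize (G1 H)].
  destruct (Rle_lt_dec (mu * t - c) (L * INR N2 * 4 ^ k)) as [H'|H'];
    [now apply (Fin _ _ I1)|specialize (G2 H')].
  destruct (Rle_lt_dec (mu * t - c) (L * INR N3 * 4 ^ k)) as [H''|H''];
    [now apply (Fin _ _ I2)|specialize (G3 H'')].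
  apply (Fin _ _ I3); [simpl in Hhi; lra|exact G3].
Qed.

(** * The four forms *)

(* [A_N + B_N S(z) + C_N S(z^4)] vanishes at [0] to order exactly [N]; these Hermite-Pade
   forms were found by linear algebra, with degrees 10, 32, 42, 43. *)
Definition A64 : list Z :=
   [-1]%Z.
Definition B64 : list Z :=
   [0; -1; 0; 0; 0; -1; 0; 0; 0; -1]%Z.
Definition C64 : list Z :=
   [1; 1; 1; 0; 0; 1; 1; 0; 1; 1; 1]%Z.
Definition A108 : list Z :=
   [-1; 0; 0; 0; -1; 0; 0; 0; 0; 0; 0; 0; 1; 0; 0; 0; 1; 0; 0; 0; 1]%Z.
Definition B108 : list Z :=
   [0; -2; 0; 0; 0; -4; 0; 0; 0; -4; 0; 0; 0; -2; 0; 0; 0; 0; 0; 0; 0; -1; 0; 0; 0; -2; 0;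
   0; 0; -1]%Z.
Definition C108 : list Z :=
   [1; 2; 2; 0; 2; 4; 4; 0; 2; 4; 4; 0; 2; 2; 2; 0; 0; 0; 0; 0; 0; 1; 1; 0; 1; 2; 2; 0; 1;
   1; 1; 0; 1]%Z.
Definition A127 : list Z :=
   [0; -1; 0; 1; 0; 0; 0; -1; 0; 0; 0; 0; 0; 0; 0; 1; 0; 0; 0; 0; 0; 0; 0; 0; 0; 0; 0; 0; 0;
   0; 0; -1]%Z.
Definition B127 : list Z :=
   [0; 0; -1; 0; 1; 0; -1; 0; 0; 0; -1; 0; 0; 0; 0; 0; 0; 0; 0; 0; 2; 0; -1; 0; 3; 0; -1; 0;
   0; 0; 0; 0; -1; 0; -1; 0; 2; 0; -1; 0; 1; 0; -1]%Z.
Definition C127 : list Z :=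
   [0; 1; 1; 0; -1; -1; 1; 2; 0; 1; 1; 0; 0; 0; 0; 0; 0; 0; 0; 0; -2; -2; 1; -1; -3; -2; 1;
   0; 0; 0; 0; 1; 1; 2; 1; 0; -2; -2; 1; 1; -1; 0; 1]%Z.
Definition A171 : list Z :=
   [0; 0; 0; 0; 0; 0; 0; 0; 0; 0; 0; 0; 0; 0; 0; 0; 0; 0; 0; 0; 0; 0; 0; 0; 0; 0; 0; 0; 0;
   0; 0; 0; 0; 0; 0; 0; 0; 0; 0; 0; 0; 0; 0; 1]%Z.
Definition B171 : list Z :=
   [-1; 0; 0; 0; -1; 0; 0; 0; 0; 0; 0; 0; -1; 0; 0; 0; -1; 0; 0; 0; -1]%Z.
Definition C171 : list Z :=
   [1; 1; 0; 1; 1; 1; 0; 0; 0; 0; 0; 1; 1; 1; 0; 0; 1; 1; 0; 1; 1; 1]%Z.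

(** For [z = a/b] the hypothesis on [lambda] reads [-ln |z| = (1 - lambda) ln b]. Dividing by [ln b]
    therefore makes the conditions of [mu2_chain] inequalities in [lambda] alone. The denominator
    comes from the form of order 127: [127 (1 - lambda) - (42 + 2/3) = (253 - 381 lambda) / 3]. *)
Lemma mu2_rational_le (b a : Z) (lambda : R) :
  (2 <= b)%Z -> a <> 0%Z -> ln (Rabs (IZR a)) = lambda * ln (IZR b) ->
  0 <= lambda < 178 / 291 ->
  Rbar_le (mu2 (S_series (IZR a / IZR b)) (S_series (IZR a ^ 4 / IZR b ^ 4)))
          (Finite (516 * (1 - lambda) / (253 - 381 * lambda))).
Proof.
  intros Hb Ha Hln Hlam.
  assert (HbR : 2 <= IZR b) by now apply IZR_le.
  set (z := IZR a / IZR b). set (beta := ln (IZR b)). set (L := (1 - lambda) * beta).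
  assert (Hbeta : 0 < beta) by (unfold beta; rewrite <- ln_1; apply ln_increasing; lra).
  assert (HL : 0 < L) by (apply Rmult_lt_0_compat; lra).
  assert (Eb : IZR b = exp beta) by (unfold beta; rewrite exp_ln; lra).
  assert (Ez : Rabs z = exp (- L)).
  { unfold z, L. rewrite Rabs_div, (Rabs_pos_eq (IZR b)) by lra.
    rewrite <- (exp_ln (Rabs (IZR a))) by (apply Rabs_pos_lt, not_0_IZR, Ha).
    rewrite Hln. fold beta. rewrite Eb. unfold Rdiv. rewrite <- exp_Ropp, <- exp_plus.
    f_equal. ring. }
  assert (Ib : isint (IZR b)) by apply isint_IZR.
  assert (Ibz : isint (IZR b * z)).
  { exists a. unfold z. field. lra. }
  assert (Form : forall A0 A1 A2 n N, has_order A0 A1 A2 N = true ->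
     (length A0 <= S n)%nat -> (length A1 <= S n)%nat -> (length A2 <= S n)%nat ->
     exists c, 0 <= c /\ gap z beta L n N c).
  { intros A0 A1 A2 n N H H0 H1 H2.
    apply (form_gap_ln A0 A1 A2 n N (IZR b)); try assumption. lra. }
  destruct (Form A64 B64 C64 10%nat 64%nat) as (c0 & Hc0 & G0);
    [vm_compute; reflexivity | simpl; lia | simpl; lia | simpl; lia |].
  destruct (Form A108 B108 C108 32%nat 108%nat) as (c1 & Hc1 & G1);
    [vm_compute; reflexivity | simpl; lia | simpl; lia | simpl; lia |].
  destruct (Form A127 B127 C127 42%nat 127%nat) as (c2 & Hc2 & G2);
    [vm_compute; reflexivity | simpl; lia | simpl; lia | simpl; lia |].
  destruct (Form A171 B171 C171 43%nat 171%nat) as (c3 & Hc3 & G3);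
    [vm_compute; reflexivity | simpl; lia | simpl; lia | simpl; lia |].
  set (c := c0 + c1 + c2 + c3).
  apply (gap_weaken _ _ _ _ c) in G0; [|unfold c; lra].
  apply (gap_weaken _ _ _ _ c) in G1; [|unfold c; lra].
  apply (gap_weaken _ _ _ _ c) in G2; [|unfold c; lra].
  apply (gap_weaken _ _ _ _ c) in G3; [|unfold c; lra].
  assert (Hden : 0 < 253 - 381 * lambda) by lra.
  (* [Y] is the order of a form, [W] its degree bound plus [2/3], and [X] the next order; with
     denominators cleared, each condition is linear in [lambda]. *)
  assert (Level : forall X Y W, X * (253 - 381 * lambda) <= 516 * ((1 - lambda) * Y - W) ->
    L * X <= 516 * (1 - lambda) / (253 - 381 * lambda) * (L * Y - beta * W)).
  { intros X Y W H. apply (Rmult_le_reg_r (253 - 381 * lambda)); [exact Hden|].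
    replace (516 * (1 - lambda) / (253 - 381 * lambda) * (L * Y - beta * W)
             * (253 - 381 * lambda))
      with (L * (516 * ((1 - lambda) * Y - W))) by (unfold L; field; lra).
    rewrite Rmult_assoc. apply Rmult_le_compat_l; lra. }
  replace (IZR a ^ 4 / IZR b ^ 4) with (z ^ 4) by (unfold z; field; lra).
  rewrite !S_series_gen.
  apply (mu2_chain z beta L c _ 10 32 42 43 64 108 127 171); try assumption; try lia.
  - unfold c; lra.
  - apply Rdiv_lt_0_compat; lra.
  - apply Level. rewrite !INR_IZR_INZ. simpl. lra.
  - apply Level. rewrite !INR_IZR_INZ. simpl. lra.
  - apply Level. rewrite !INR_IZR_INZ. simpl. lra.
  - apply Level. rewrite !INR_IZR_INZ. simpl. lra.
Qed.

Theorem theorem4 : forall b : Z, (2 <= b)%Z ->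
  Rbar_le (mu2 (S_series (1 / IZR b)) (S_series (1 / IZR b ^ 4)))
          (Finite (516 / 253))
  /\
  (forall (a : Z) (lambda : R),
     a <> 0%Z ->
     ln (Rabs (IZR a)) = lambda * ln (IZR b) ->
     0 <= lambda < 178 / 291 ->
     Rbar_le (mu2 (S_series (IZR a / IZR b)) (S_series (IZR a ^ 4 / IZR b ^ 4)))
             (Finite (516 * (1 - lambda) / (253 - 381 * lambda)))).
Proof.
  intros b Hb. split.
  - assert (H1 : ln (Rabs 1) = 0 * ln (IZR b)) by (rewrite Rabs_R1, ln_1; ring).
    pose proof (mu2_rational_le b 1 0 Hb ltac:(lia) H1 ltac:(lra)) as H.
    rewrite pow1 in H.
    replace (516 * (1 - 0) / (253 - 381 * 0)) with (516 / 253) in H by field.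
    exact H.
  - intros a lambda. now apply mu2_rational_le.
Qed.
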